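(* Every pairwise $T_{\frac14}$ generalized bitopological space $(X,\mu_1,\mu_2)$ is pairwise $T_0$.
   Context: A generalized topology on a nonempty set $X$ is a collection $\mu$ of subsets of $X$ that contains $\emptyset$ and is closed under arbitrary unions ($X$ itself need not belong to $\mu$). Members of $\mu$ are called $\mu$-open and their complements $\mu$-closed. A generalized bitopological space (GBT-space) $(X,\mu_1,\mu_2)$ is a nonempty set $X$ with two generalized topologies $\mu_1,\mu_2$. The space is pairwise $T_{\frac14}$ if for every finite subset $P$ of $X$ and every $y\in X-P$ there exists a set $A_y$ containing $P$ and disjoint from $\{y\}$ such that $A_y$ is $\mu_i$-open for some $i\in\{1,2\}$ or $\mu_j$-closed for some $j\in\{1,2\}$. The space is pairwise $T_0$ if for any two distinct points of $X$, the two points can be named $x,y$ (in one of the two possible orders) so that either there is a $\mu_1$-open set $U$ with $x\in U$, $y\notin U$, or there is a $\mu_2$-open set $V$ with $y\in V$, $x\notin V$. *)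

(* Defs.v *)
From mathcomp Require Import all_boot.
From mathcomp Require Import boolp classical_sets functions cardinality.

Set Implicit Arguments.
Unset Strict Implicit.
Unset Printing Implicit Defensive.

Local Open Scope classical_set_scope.

(* The whole space [set: X] is not required to be open. *)
Record gtopology (X : Type) := GTopology {
  gopen : set (set X);
  gopen_set0 : gopen set0;
  gopen_bigcup : forall F : set (set X),
    F `<=` gopen -> gopen (\bigcup_(A in F) A)
}.

Definition gclosed (X : Type) (mu : gtopology X) (A : set X) : Prop :=
  gopen mu (~` A).

Record gbtSpace := GBTSpace {
  carrier :> Type;
  carrier_nonempty : [set: carrier] !=set0;
  gtop1 : gtopology carrier;
  gtop2 : gtopology carrier
}.

Definition pairwise_T14 (X : gbtSpace) : Prop :=
  forall (P : set X) (y : X), finite_set P -> (~` P) y ->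
    exists A : set X,
      [/\ P `<=` A,
          A `&` [set y] = set0 &
          (gopen (gtop1 X) A \/ gopen (gtop2 X) A) \/
          (gclosed (gtop1 X) A \/ gclosed (gtop2 X) A)].

(* Ordered separation: the first topology separates x from y,
   or the second separates y from x. *)
Definition separated12 (X : gbtSpace) (x y : X) : Prop :=
  (exists U : set X, [/\ gopen (gtop1 X) U, U x & ~ U y]) \/
  (exists V : set X, [/\ gopen (gtop2 X) V, V y & ~ V x]).

(* The pair is unordered: the two points may be named in either order. *)
Definition pairwise_T0 (X : gbtSpace) : Prop :=
  forall a b : X, a <> b -> separated12 a b \/ separated12 b a.

(* Main.v *)
Require Import Defs.
From mathcomp Require Import all_boot.
From mathcomp Require Import boolp classical_sets functions cardinality.

(** Apply the $T_{\frac14}$ condition to the singleton $P=\{a\}$ and $y=b$: this gives a set [A]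
    containing [a] but not [b]. If [A] is open it separates the points itself; if closed, its
    complement does. *)

Theorem theorem5p2 (X : gbtSpace) (hX : pairwise_T14 X) : pairwise_T0 X.
Proof.
move=> a b ab.
have [A [aA Ab0 hA]] := hX [set a]%classic b (finite_set1 a) (nesym ab).
have Aa : A a by exact: aA.
have nAb : ~ A b.
  by move=> Ab; have : (A `&` [set b])%classic b by []; rewrite Ab0.
(* The order of naming is forced by which topology is involved and which point the open set
   contains: [a] comes first when [A] is $\mu_1$-open or $\mu_2$-closed, [b] in the other two
   cases. *)
case: hA => -[] oA.
- by left; left; exists A.
- by right; right; exists A.
- by right; left; exists (~` A)%classic; split=> //; apply.
- by left; right; exists (~` A)%classic; split=> //; apply.
Qed.
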